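(* Let $0<a<b<\infty$ and assign to the edges of the $\mathbb{Z}^2$ nearest-neighbour lattice independent weights $(\omega_e)$, each uniformly distributed on $\{a,b\}$. For any $\alpha<1/22$, any sequence $(k_n)_{n\ge1}$ of positive integers with $k_n\le n^\alpha$, and any fixed $c>0$, we have $$\sup_{x\ge0}\mathbb{P}\big(\tau(n,k_n)\in[x,x+c]\big)=o\Big(\frac{1}{n^{1/22}}\Big)\quad\text{as }n\to\infty.$$
   Context: For a path $\Gamma$, $T(\Gamma):=\sum_{e\in\Gamma}\omega_e$. For $k\ge1$, $\mathcal{P}_k(n)$ is the set of nearest-neighbour paths contained in $[0,n]\times[0,n-1]$ that connect the left side $\{0\}\times[0,n-1]$ to the right side $\{n\}\times[0,n-1]$ and are contained in $[0,n]\times[m,m+k-1]$ for some integer $m$; and $\tau(n,k):=\inf\{T(\Gamma):\Gamma\in\mathcal{P}_k(n)\}$. *)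

(* Defs.v *)
From HB Require Import structures.
From mathcomp Require Import all_boot all_order all_algebra.
From mathcomp Require Import classical_sets boolp reals exp.

Set Implicit Arguments.
Unset Strict Implicit.
Unset Printing Implicit Defensive.
Import Order.TTheory GRing.Theory Num.Theory.
Local Open Scope ring_scope.
Local Open Scope classical_set_scope.

Definition V (n : nat) := ('I_n.+1 * 'I_n)%type.

Definition adj (n : nat) (u v : V n) : bool :=
  ((nat_of_ord u.1 == nat_of_ord v.1) &&
     (((nat_of_ord u.2).+1 == nat_of_ord v.2) || ((nat_of_ord v.2).+1 == nat_of_ord u.2)))
  || ((nat_of_ord u.2 == nat_of_ord v.2) &&
     (((nat_of_ord u.1).+1 == nat_of_ord v.1) || ((nat_of_ord v.1).+1 == nat_of_ord u.1))).

Definition in_Pk (n k : nat) (g : seq (V n)) : Prop :=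
  exists (u : V n) (p : seq (V n)),
    [/\ g = u :: p, path (@adj n) u p, uniq g &
        nat_of_ord u.1 = 0%N] /\ nat_of_ord (last u p).1 = n /\
        (exists m : int, all (fun v : V n =>
            (m <= (nat_of_ord v.2)%:Z) && ((nat_of_ord v.2)%:Z <= m + (k%:Z) - 1)) g).

(* A weight configuration: omega e = true means weight b, false means weight a.
   Edges are the 2-element vertex sets {u,v}; coordinates of omega at other sets
   are irrelevant (they are never read). *)
Definition config (n : nat) := {ffun {set V n} -> bool}.

Section Passage.
Variable R : realType.

Definition wt (a b : R) (n : nat) (om : config n) (e : {set V n}) : R :=
  if om e then b else a.

Definition Tpath (a b : R) (n : nat) (om : config n) (g : seq (V n)) : R :=
  \sum_(e <- zip g (behead g)) wt a b om [set e.1; e.2].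

Definition tau (a b : R) (n k : nat) (om : config n) : R :=
  inf [set t | exists g, in_Pk k g /\ t = Tpath a b om g].

(* P(tau(n,k) in [x, x+c]) where the weights are i.i.d. uniform on {a,b}:
   the uniform (counting) measure on configurations of the (finitely many)
   edges of the box, on which tau(n,k) depends. *)
Definition prob_window (a b : R) (n k : nat) (x c : R) : R :=
  (#|[set om : config n | (x <= tau a b k om) && (tau a b k om <= x + c)]|%:R)
  / (#|{: config n}|%:R).

End Passage.

(* Main.v *)
Require Import Defs.
From HB Require Import structures.
From mathcomp Require Import all_boot all_order all_algebra.
From mathcomp Require Import classical_sets boolp reals exp.
From mathcomp Require Import zify ring lra.
From mathcomp Require Import fintype finset.
Import Order.TTheory GRing.Theory Num.Theory.

Set Implicit Arguments.
Unset Strict Implicit.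
Unset Printing Implicit Defensive.

(* Fix a window [x, x + (b - a)).  If tau lies in it, some strip m has a crossing
   of time < x + (b - a) while no strip has one of time < x.  Turning a b-edge
   of that crossing into an a-edge makes strip m "fast" (time < x), and strips
   disjoint from m stay slow.  Let D_m be the event that m is fast and all
   strips disjoint from m are slow.  As D_m is decreasing in the weights of strip
   m, the number of pairs (configuration, edge) through which it is entered is
   at most twice the sum over D_m of X_m = #a-edges - #b-edges in strip m.  At
   most k of the D_m hold at once, so the sum over m of E[X_m; D_m] is at most
   E[k s + sum_m X_m^4 / s^3], and the fourth moments of the X_m are explicit.

   It remains to see that crossings have many b-edges.  Cut a strip into k x k
   chunks.  By planar self-duality a chunk has an a-crossing with probability at
   most 1/2, independently for distinct chunks, so up to an exponentially small
   probability a positive fraction of the n/k chunks forces a b-edge on every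
   crossing.  With k <= t = n^(1/22) and s = t^18 the window has probability
   O(t^-2). *)

(** * Boundary edges of decreasing events on the cube *)

Section Cube.
Local Open Scope ring_scope.
Variables (R : realFieldType) (E : finType).
Implicit Types (e : E) (om : {ffun E -> bool}) (S : {set E}).

Definition flip e om : {ffun E -> bool} :=
  [ffun e' => if e' == e then ~~ om e' else om e'].

Lemma flipK e : involutive (flip e).
Proof.
by move=> om; apply/ffunP => e'; rewrite !ffunE; case: eqP => //; rewrite negbK.
Qed.

Lemma sum_flip e (F : {ffun E -> bool} -> R) :
  \sum_om F om = \sum_om F (flip e om).
Proof. by rewrite (reindex_inj (can_inj (flipK e))). Qed.

(** As [true] encodes weight b, the sign is 1 on a-edges and -1 on b-edges, so that [excess] is the
    number of a-edges minus that of b-edges. *)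
Definition sgn e om : R := (-1) ^+ om e.

Lemma sgn_flip e om : sgn e (flip e om) = - sgn e om.
Proof. by rewrite /sgn ffunE eqxx; case: (om e); rewrite /= ?expr1 ?expr0 ?opprK. Qed.

Lemma sgn_flip_neq e e' om : e' != e -> sgn e' (flip e om) = sgn e' om.
Proof. by move=> ne; rewrite /sgn ffunE (negPf ne). Qed.

Lemma sgn_sqr e om : sgn e om ^+ 2 = 1.
Proof. exact: sqrr_sign. Qed.

Lemma sum_odd e (F : {ffun E -> bool} -> R) :
  (forall om, F (flip e om) = - F om) -> \sum_om F om = 0.
Proof.
move=> Fodd; have := sum_flip e F.
under [in RHS]eq_bigr => om _ do rewrite Fodd.
rewrite sumrN => eqF; lra.
Qed.

Definition excess S om : R := \sum_(e in S) sgn e om.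

(** Remove one edge at a time: terms odd in its sign cancel under [flip]. The fourth moment picks up
    6 times the second, hence the joint induction, which closes by
    [3 c^2 + 6 c + 1 <= 3 (c + 1)^2]. *)
Lemma excess_moments S :
  \sum_om excess S om ^+ 2 = #|S|%:R * #|{ffun E -> bool}|%:R /\
  \sum_om excess S om ^+ 4 <= 3 * #|S|%:R ^+ 2 * #|{ffun E -> bool}|%:R.
Proof.
have [m] := ubnP #|S|; elim: m S => // m IH S; rewrite ltnS => leS.
have [->|[e eS]] := set_0Vmem S.
  have ex0 d om : excess set0 om ^+ d.+1 = 0 by rewrite /excess big_set0 expr0n.
  by rewrite cards0 expr0n /= mulr0 !mul0r !big1.
have cS : #|S| = (#|S :\ e|).+1 by rewrite (cardsD1 e S) eS.
have [|IH2 IH4] := IH (S :\ e); first by rewrite -cS.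
set Z := excess (S :\ e) in IH2 IH4.
have defZ om : excess S om = sgn e om + Z om by rewrite /excess (big_setD1 e).
have Zflip om : Z (flip e om) = Z om.
  by apply: eq_bigr => e'; rewrite !inE => /andP[ne _]; rewrite sgn_flip_neq.
have cardE : \sum_(om : {ffun E -> bool}) (1 : R) = #|{ffun E -> bool}|%:R.
  by rewrite sumr_const cardT.
have odd1 : \sum_om Z om * sgn e om = 0.
  by apply: (@sum_odd e) => om; rewrite Zflip sgn_flip mulrN.
have odd3 : \sum_om Z om ^+ 3 * sgn e om = 0.
  by apply: (@sum_odd e) => om; rewrite Zflip sgn_flip mulrN.
have E2 om : excess S om ^+ 2 = Z om ^+ 2 + 2 * (Z om * sgn e om) + 1.
  by rewrite defZ sqrrD sgn_sqr; ring.
have E4 om : excess S om ^+ 4 =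
    Z om ^+ 4 + 4 * (Z om ^+ 3 * sgn e om) + 6 * Z om ^+ 2 + 4 * (Z om * sgn e om) + 1.
  rewrite defZ; have := sgn_sqr e om; move: (sgn e om) (Z om) => s z s2.
  have -> : (s + z) ^+ 4 = z ^+ 4 + 4 * (z ^+ 3 * s) + 6 * z ^+ 2 * s ^+ 2
     + 4 * (z * s) * s ^+ 2 + s ^+ 2 * s ^+ 2 by ring.
  by rewrite s2; ring.
split.
  rewrite (eq_bigr _ (fun om _ => E2 om)) !big_split /= -mulr_sumr odd1 IH2 cardE cS.
  by rewrite -[in RHS]natr1; ring.
rewrite (eq_bigr _ (fun om _ => E4 om)) !big_split /= -!mulr_sumr odd1 odd3 IH2 cardE cS.
rewrite -[#|S :\ e|.+1]addn1 natrD.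
have c0 : 0 <= #|S :\ e|%:R :> R by [].
have d0 : 0 <= #|{ffun E -> bool}|%:R :> R by [].
nra.
Qed.

(** A form of Russo's formula: pairing [om] with [flip e om] turns the correlation of [D] with the
    sign at [e] into a sum of discrete derivatives, to which each pivotal configuration
    contributes. *)
Lemma pivotal_le (D : pred {ffun E -> bool}) e :
  (forall om, om e -> D om -> D (flip e om)) ->
  #|[set om : {ffun E -> bool} | [&& om e, ~~ D om & D (flip e om)]]|%:R
    <= 2 * \sum_om (D om)%:R * sgn e om.
Proof.
move=> Dmon.
have -> : 2 * \sum_om (D om)%:R * sgn e om =
    \sum_om ((D om)%:R - (D (flip e om))%:R) * sgn e om.
  under [RHS]eq_bigr => om _ do rewrite mulrBl.
  rewrite sumrB [X in _ - X](sum_flip e).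
  under [X in _ - X]eq_bigr => om _ do rewrite flipK sgn_flip mulrN.
  by rewrite sumrN; ring.
(* By monotonicity every summand is nonnegative. *)
rewrite -sum1_card natr_sum big_mkcond /=.
apply: ler_sum => om _; rewrite inE /sgn.
have := Dmon om; have := Dmon (flip e om); rewrite flipK ffunE eqxx.
case: (om e); case: (D om); case: (D (flip e om)) => //= H1 H2;
  rewrite ?expr1 ?expr0; try lra; by [move: (H1 isT isT) | move: (H2 isT isT)].
Qed.

Lemma le_fourth (X s : R) : 0 < s -> X <= s + X ^+ 4 / s ^+ 3.
Proof.
move=> s0; have s3 : 0 < s ^+ 3 by rewrite exprn_gt0.
have X4 : 0 <= X ^+ 4 by rewrite exprn_even_ge0.
have [Xs|sX] := lerP X s; first by rewrite ler_wpDr // divr_ge0 // ltW.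
rewrite ler_wpDl ?(ltW s0) // ler_pdivlMr // (exprS X 3) ler_pM2l ?(lt_trans s0) //.
by rewrite lerXn2r ?nnegrE ?ltW // (lt_trans s0).
Qed.

(** In the application [S i] is the edge set of strip [i], [L i] says that the strip is fast, and
    [W i] that it has a crossing of time below [x + (b - a)] and at least [beta] blocked chunks. *)
Theorem anticoncentration (I : finType) (S : I -> {set E})
    (L W : I -> pred {ffun E -> bool}) (beta K N : nat) (s : R) :
  0 < s ->
  (forall i e om, e \notin S i -> L i (flip e om) = L i om) ->
  (forall i e om, om e -> L i om -> L i (flip e om)) ->
  (forall i om, W i om -> ~~ L i om ->
     (beta <= #|[set e in S i | om e && L i (flip e om)]|)%N) ->
  (forall J : {set I}, {in J &, forall i j, ~~ [disjoint S i & S j]} -> (#|J| <= K)%N) ->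
  (forall i, #|S i| <= N)%N ->
  beta%:R * #|[set om | [exists i, W i om] && [forall l, ~~ L l om]]|%:R
    <= 2 * #|{ffun E -> bool}|%:R * (K%:R * s + 3 * #|I|%:R * N%:R ^+ 2 / s ^+ 3).
Proof.
move=> s0 Lloc Lmon Wpiv HK HN.
pose D i om := L i om && [forall l, [disjoint S l & S i] ==> ~~ L l om].
pose F i := [set om | W i om && [forall l, ~~ L l om]].
have Dmon i e om : e \in S i -> om e -> D i om -> D i (flip e om).
  move=> eS ome /andP[Li /forallP Ll]; rewrite /D Lmon //=.
  apply/forallP => l; apply/implyP => dis; rewrite Lloc.
    exact: (implyP (Ll l)).
  by apply/negP => eSl; move: dis => /pred0P/(_ e) /=; rewrite eSl eS.
(* Strips whose events hold at once pairwise meet: each is fast, while everything disjoint from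
   either one is slow. *)
have DK om : \sum_i (D i om)%:R <= K%:R :> R.
  rewrite -natr_sum ler_nat.
  suff -> : (\sum_i D i om = #|[set i | D i om]|)%N.
    apply: HK => i j; rewrite !inE => /andP[Li _] /andP[_ /forallP/(_ i)].
    by rewrite Li; case: [disjoint _ & _].
  by rewrite -sum1_card [RHS]big_mkcond /=; apply: eq_bigr => i _; rewrite inE; case: (D i om).
(* A configuration of [F i] lies outside [D i] and has [beta] edges whose flip enters it, since
   flips inside [S i] keep the disjoint strips slow. Summing [pivotal_le] over the edges counts
   these pairs. *)
have FD i : beta%:R * #|F i|%:R <= 2 * \sum_om (D i om)%:R * excess (S i) om.
  have -> : 2 * \sum_om (D i om)%:R * excess (S i) om =
      \sum_(e in S i) 2 * \sum_om (D i om)%:R * sgn e om.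
    rewrite -mulr_sumr exchange_big /=; congr (_ * _).
    by apply: eq_bigr => om _; rewrite /excess mulr_sumr.
  apply: (@le_trans _ _
    (\sum_(e in S i) #|[set om : {ffun E -> bool} |
        [&& om e, ~~ D i om & D i (flip e om)]]|%:R)); last first.
    apply: ler_sum => e eS; apply: pivotal_le => om; exact: Dmon.
  rewrite -natr_sum -natrM ler_nat.
  under [leqRHS]eq_bigr => e _ do rewrite -sum1_card big_mkcond /=.
  rewrite exchange_big /= mulnC -sum_nat_const big_mkcond /=.
  apply: leq_sum => om _; case: ifP => // /[!inE] /andP[Wi noL].
  apply: leq_trans (Wpiv i om Wi (forallP noL i)) _.
  rewrite -sum1_card big_mkcond [leqRHS]big_mkcond /=.
  apply: leq_sum => e _; rewrite !inE; case: ifP => // /and3P[eS ome Le].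
  rewrite eS ome /D (negPf (forallP noL i)) Le /= ifT //.
  apply/forallP => l; apply/implyP => dis; rewrite Lloc; first exact: (forallP noL).
  by apply/negP => eSl; move: dis => /pred0P/(_ e) /=; rewrite eSl eS.
have cF : #|[set om | [exists i, W i om] && [forall l, ~~ L l om]]|%:R
    <= \sum_i #|F i|%:R :> R.
  rewrite -natr_sum ler_nat.
  apply: leq_trans (_ : #|\bigcup_i F i| <= _)%N; last first.
    by elim/big_rec2: _ => [|i y1 y2 _ le]; rewrite ?cards0 // (leq_trans (leq_card_setU _ _)) ?leq_add2l.
  apply: subset_leq_card; apply/subsetP => om; rewrite inE => /andP[/existsP[i Wi] noL].
  by apply/bigcupP; exists i => //; rewrite inE Wi.
apply: le_trans (ler_wpM2l (ler0n _ _) cF) _.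
rewrite mulr_sumr; apply: le_trans (ler_sum _ (fun i _ => FD i)) _.
rewrite -mulr_sumr -mulrA ler_pM2l // exchange_big /=.
pose Om : R := #|{ffun E -> bool}|%:R.
apply: (@le_trans _ _ (\sum_om (K%:R * s + \sum_i excess (S i) om ^+ 4 / s ^+ 3))).
  apply: ler_sum => om _.
  (* [le_fourth] is applied only where [D i] holds, so that [s] is paid at most [K] times. *)
  apply: (@le_trans _ _ (\sum_i ((D i om)%:R * s + excess (S i) om ^+ 4 / s ^+ 3))).
    apply: ler_sum => i _; case: (D i om); rewrite ?mul1r ?mul0r ?add0r; first exact: le_fourth.
    by apply: divr_ge0; [exact: exprn_even_ge0 | exact: exprn_ge0 (ltW s0)].
  by rewrite big_split /= lerD2r -mulr_suml ler_pM2r.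
rewrite big_split /= sumr_const cardT -cardE.
rewrite exchange_big /= mulrDr -[(_ * s) *+ _]mulr_natl lerD2l.
under eq_bigr => i _ do rewrite -mulr_suml.
rewrite -mulr_suml mulrA ler_wpM2r //.
  by rewrite invr_ge0 exprn_ge0 // ltW.
apply: (@le_trans _ _ (\sum_(i : I) 3 * N%:R ^+ 2 * Om)).
  apply: ler_sum => i _; apply: le_trans (proj2 (excess_moments _)) _.
  rewrite ler_wpM2r ?ler0n // ler_wpM2l // lerXn2r ?nnegrE ?ler0n //.
  by rewrite ler_nat.
have -> : \sum_(i : I) 3 * N%:R ^+ 2 * Om = Om * (3 * #|I|%:R * N%:R ^+ 2).
  by rewrite sumr_const cardT -cardE -mulr_natl; ring.
exact: lexx.
Qed.

(* [2 ^ - #blocked] has mean at most [(3 / 4) ^ M], whence a Chernoff bound. *)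
Lemma few_successes_le (M : nat) (X : nat -> pred {ffun E -> bool})
    (Phi : nat -> {ffun E -> bool} -> {ffun E -> bool}) (beta : nat) :
  (8 * beta <= M)%N ->
  (forall j, (j < M)%N -> injective (Phi j)) ->
  (forall j om, (j < M)%N -> X j om || X j (Phi j om)) ->
  (forall j j' om, (j < M)%N -> (j' < M)%N -> j != j' -> X j' (Phi j om) = X j' om) ->
  #|[set om | \sum_(j < M) X j om < beta]%N|%:R * 4 ^+ beta
    <= #|{ffun E -> bool}|%:R :> R.
Proof.
move=> le8 Phi_inj XPhi Xloc.
pose r (c : bool) : R := if c then 1 / 2 else 1.
have rE c : r c = 2^-1 ^+ c by rewrite /r; case: c; rewrite ?expr1 ?expr0 ?div1r.
have r0 c : 0 <= r c by rewrite /r; case: c; lra.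
have mean m : (m <= M)%N ->
    \sum_om \prod_(j < m) r (X j om) <= (3 / 4) ^+ m * #|{ffun E -> bool}|%:R.
  elim: m => [|m IH] ltm.
    by under eq_bigr => om _ do rewrite big_ord0; rewrite sumr_const cardT -cardE expr0 mul1r.
  under eq_bigr => om _ do rewrite big_ord_recr /=.
  set F := fun om => \prod_(j < m) r (X j om).
  have FPhi om : F (Phi m om) = F om.
    apply: eq_bigr => j _; rewrite Xloc //; first exact: ltn_trans ltm.
    by rewrite gtn_eqF.
  have := IH (ltnW ltm); rewrite exprS -/F.
  have F0 om : 0 <= F om by apply: prodr_ge0.
  (* [Phi m] preserves the earlier factors, so the last one may be averaged over [om] and
     [Phi m om]. One of the two is a success, so the average is at most [(1/2 + 1) / 2 = 3/4]. *)
  have eq2 : \sum_om F om * r (X m om) = \sum_om F om * r (X m (Phi m om)).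
    rewrite (reindex_inj (Phi_inj m ltm)); apply: eq_bigr => om _; by rewrite FPhi.
  have : \sum_om F om * r (X m om) + \sum_om F om * r (X m (Phi m om))
      <= 3 / 2 * \sum_om F om.
    rewrite -big_split /= mulr_sumr; apply: ler_sum => om _.
    rewrite -mulrDr mulrC ler_wpM2r // /r.
    by have := XPhi m om ltm; case: (X m om); case: (X m _) => //= _; lra.
  rewrite -eq2 -mulrA; lra.
have {mean} := mean M (leqnn _).
have le2 : #|[set om | \sum_(j < M) X j om < beta]%N|%:R * 2^-1 ^+ beta
    <= \sum_om \prod_(j < M) r (X j om).
  rewrite -sum1_card natr_sum mulr_suml big_mkcond /=.
  apply: ler_sum => om _; rewrite inE; case: ifP => [lt|_]; last exact: prodr_ge0.
  rewrite mul1r; under eq_bigr => j _ do rewrite rE.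
  rewrite -expr_sum.
  by rewrite ler_wiXn2l ?invr_ge0 ?invf_le1 ?ler1n // ltnW.
move=> /(le_trans le2) {}le2.
(* This rests on [(3/4)^8 <= 1/8]. Dividing by the factor [2^-1 ^+ beta] of [le2] leaves the power
   of 4. *)
have : (3 / 4) ^+ M <= 8^-1 ^+ beta :> R.
  apply: (@le_trans _ _ ((3 / 4) ^+ (8 * beta))).
    by rewrite ler_wiXn2l //; lra.
  by rewrite exprM; apply: lerXn2r; rewrite ?nnegrE ?exprn_ge0 ?invr_ge0 //; lra.
move=> /(ler_wpM2r (ler0n _ #|{ffun E -> bool}|)) /(le_trans le2).
have -> : 8^-1 ^+ beta = 2^-1 ^+ beta * (4 ^+ beta)^-1 :> R.
  by rewrite -exprVn -exprMn; congr (_ ^+ _); lra.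
rewrite mulrC -mulrA ler_pM2l ?exprn_gt0 ?invr_gt0 //.
by rewrite mulrC ler_pdivlMr ?exprn_gt0.
Qed.

End Cube.

(** * Planar duality in a square *)

Section Parity.
Variable T : eqType.
Implicit Types (c : T -> T -> bool) (p : T) (s : seq T).

Fixpoint parity c p s : bool :=
  if s is q :: s' then c p q (+) parity c q s' else false.

Lemma parity_eq (e : rel T) c c' p s :
  path e p s -> (forall p q, e p q -> c p q = c' p q) ->
  parity c p s = parity c' p s.
Proof. by move=> + cc'; elim: s p => //= q s IH p /andP[/cc' -> /IH ->]. Qed.

Lemma parity_boundary (r : pred T) p s :
  parity (fun p q => r p (+) r q) p s = r p (+) r (last p s).
Proof.
elim: s p => [|q s IH] p /=; first by rewrite addbb.
by rewrite IH; case: (r p); case: (r q); case: (r _).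
Qed.

Lemma parityD c c' p s :
  parity (fun p q => c p q (+) c' p q) p s = parity c p s (+) parity c' p s.
Proof. by elim: s p => //= q s IH p; rewrite IH addbACA. Qed.

Lemma parity0 p s : parity (fun _ _ => false) p s = false.
Proof. by elim: s p => //= q s IH p. Qed.

End Parity.

(* [h x y] ([v x y]) says that the edge from [(x, y)] to [(x+1, y)] (to [(x, y+1)])
   is closed.  Vertical edges on the sides [x = 0] and [x = w] may not be used:
   this is what makes the square self-dual. *)
Definition hbond (w : nat) (h : nat -> nat -> bool) (p q : nat * nat) :=
  [&& q.1 == p.1.+1, p.2 == q.2, p.1 < w, p.2 < w & ~~ h p.1 p.2].

Definition vbond (w : nat) (v : nat -> nat -> bool) (p q : nat * nat) :=
  [&& p.1 == q.1, q.2 == p.2.+1, 0 < p.1 < w, q.2 < w & ~~ v p.1 p.2].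

Definition cstep w h v (p q : nat * nat) :=
  [|| hbond w h p q, hbond w h q p, vbond w v p q | vbond w v q p].

Definition crossing w h v :=
  exists y s, [/\ y < w, path (cstep w h v) (0, y) s & (last (0, y) s).1 = w].

(* A point [(X, Y)] of the second crossing stands for the point [(Y + 1/2, X - 1/2)]
   of the dual lattice, so that this crossing runs from bottom to top through
   closed edges only. *)
Lemma no_double_crossing w h v :
  crossing w h v ->
  crossing w (fun x y => ~~ h y x) (fun x y => ~~ v y.+1 x.-1) -> False.
Proof.
move=> [y0 [s [y0w ps lasts]]] [z0 [t [z0w pt lastt]]].
set e := cstep w _ _ in pt.
(* [N x y]: parity of the number of times the dual path crosses the horizontal ray
   going left from [(x, y)]; the first crossing cannot change it. *)
pose N x y := parity (fun p q : nat * nat =>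
  (p.2 < x) && ((p.1 <= y) (+) (q.1 <= y))) (0, z0) t.
have rows p q : e p q -> (p.2 < w) && (q.2 < w).
  rewrite /e /cstep /hbond /vbond; lia.
have N0 y : N 0 y = false.
  rewrite -[RHS](parity0 (0, z0) t); exact: parity_eq pt _.
(* Seen from the right side, the ray catches every passage of the dual path through height [y], and
   this path starts below and ends above that height. *)
have Nw y : y < w -> N w y.
  move=> yw; rewrite /N (@parity_eq _ e _ (fun p q => (p.1 <= y) (+) (q.1 <= y))) //.
    by rewrite (parity_boundary (fun p => p.1 <= y)) lastt /= leqNgt yw.
  by move=> p q /rows/andP[-> _].
(* The two rays differ by the edge itself. It is open, and dual steps cross closed edges only. *)
have Nh p q : hbond w h p q -> N p.1 p.2 = N q.1 q.2.
  case: p q => [x y] [x' y'] /and5P[/= /eqP-> /eqP<- xw yw nh].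
  apply: parity_eq pt _ => -[X Y] [X' Y'].
  have key Z Z' : ~~ ~~ h Z Z' -> (Z != x) || (Z' != y).
    by apply: contraTT; rewrite negb_or !negbK => /andP[/eqP-> /eqP->]; rewrite nh.
  by case/or4P => /and5P[/= /eqP eX /eqP eY ? ?] => [/key|/key|_|_] /=; lia.
have Nv p q : vbond w v p q -> N p.1 p.2 = N q.1 q.2.
  case: p q => [x y] [x' y'] /and5P[/= /eqP<- /eqP-> xw yw nv].
  suff : N x y (+) N x y.+1 = false by case: (N x y); case: (N x y.+1).
  (* [r] is the dual row between the two rays. The dual path enters or leaves it only across one of
     the rays, the vertical edge at its end being open, and both ends of the path lie outside it
     because [0 < y.+1 < w]. *)
  pose r (p : nat * nat) := (p.2 < x) && (p.1 == y.+1).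
  rewrite /N -parityD (@parity_eq _ e _ (fun p q => r p (+) r q)) //.
    by rewrite parity_boundary /r lastt /=; lia.
  move=> [X Y] [X' Y'].
  have key Z Z' : ~~ ~~ v Z.+1 Z'.-1 -> (Z.+1 != x) || (Z'.-1 != y).
    by apply: contraTT; rewrite negb_or !negbK => /andP[/eqP-> /eqP->]; rewrite nv.
  by case/or4P => /and5P[/= /eqP eX /eqP eY ? ?] => [_|_|/key|/key]; rewrite /r /=; lia.
have steps p q : cstep w h v p q -> N p.1 p.2 = N q.1 q.2.
  by case/or4P => [/Nh|/Nh|/Nv|/Nv].
have rows' p q : cstep w h v p q -> q.2 < w.
  by rewrite /cstep /hbond /vbond; lia.
have inv s' p : path (cstep w h v) p s' -> p.2 < w ->
    N (last p s').1 (last p s').2 = N p.1 p.2 /\ (last p s').2 < w.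
  elim: s' p => //= q s' IH p /andP[pq /IH{}IH] _.
  by rewrite (steps _ _ pq); apply: IH; apply: rows' pq.
have [] := inv s _ ps y0w; rewrite lasts N0 => + /Nw; by move=> ->.
Qed.

(** * Chunks of a strip *)

Section Dualize.
Variables (E L : finType) (iota : L -> E) (sigma : L -> L).

(** Passage to the dual configuration inside a chunk, where [sigma] sends an edge to its dual. Being
    an involution, it preserves the uniform measure and can serve as [Phi] in [few_successes_le]. *)
Definition dualize (om : {ffun E -> bool}) : {ffun E -> bool} :=
  [ffun e => if [pick l | iota l == e] is Some l then ~~ om (iota (sigma l)) else om e].

Lemma dualize_out om e : e \notin codom iota -> dualize om e = om e.
Proof.
rewrite ffunE; case: pickP => // l /eqP<- /negP[]; exact: codom_f.
Qed.

Hypothesis iota_inj : injective iota.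

Lemma dualizeE om l : dualize om (iota l) = ~~ om (iota (sigma l)).
Proof.
by rewrite ffunE; case: pickP => [l' /eqP/iota_inj->|/(_ l)] //; rewrite eqxx.
Qed.

Lemma dualizeK : involutive sigma -> involutive dualize.
Proof.
move=> sigmaK om; apply/ffunP => e.
have [/codomP[l ->]|eN] := boolP (e \in codom iota).
  by rewrite !dualizeE sigmaK negbK.
by rewrite !dualize_out.
Qed.

End Dualize.

Lemma crossing_ext w (h v h' v' : nat -> nat -> bool) :
  (forall x y, x < w -> y < w -> h x y = h' x y) ->
  (forall x y, 0 < x < w -> y.+1 < w -> v x y = v' x y) ->
  crossing w h v -> crossing w h' v'.
Proof.
move=> eh ev [y [s [yw ps ls]]]; exists y, s; split=> //.
apply: sub_path ps => p q.
have eH p' q' : hbond w h p' q' -> hbond w h' p' q'.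
  by case/and5P=> ? ? ? ?; rewrite eh // => ?; apply/and5P.
have eV p' q' : vbond w v p' q' -> vbond w v' p' q'.
  case/and5P=> ? /eqP q2 p1 q2w; rewrite ev // -?q2 // => ?.
  by apply/and5P; split=> //; apply/eqP.
by case/or4P => [/eH|/eH|/eV|/eV] H; apply/or4P; rewrite H; constructor.
Qed.

Section Lattice.
Variable n' : nat.
Local Notation n := n'.+1.
Implicit Types (u v : V n) (e : {set V n}) (om : config n).

(* Junk value: coordinates outside the box are sent to [0] by [inord]. *)
Definition vx (x y : nat) : V n := (inord x, inord y).
Definition he x y := [set vx x y; vx x.+1 y].
Definition ve x y := [set vx x y; vx x y.+1].

Lemma vx_val u : vx u.1 u.2 = u.
Proof. by case: u => x y; rewrite /vx !inord_val. Qed.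

(* Twice the midpoint of an edge, which determines the edge. *)
Definition mid (e : {set V n}) := (\sum_(u in e) u.1, \sum_(u in e) u.2).

Lemma mid_set2 u v : u != v -> mid [set u; v] = (u.1 + v.1, u.2 + v.2).
Proof. by move=> uv; rewrite /mid !big_setU1 ?inE // !big_set1. Qed.

Lemma mid_he x y : x < n -> y < n -> mid (he x y) = (x.*2.+1, y.*2).
Proof.
move=> xn yn; have [E1 E2] : (vx x y).1 = x :> nat /\ (vx x.+1 y).1 = x.+1 :> nat.
  by rewrite !inordK //; lia.
rewrite mid_set2 ?E1 ?E2 ?inordK //; first by congr pair; lia.
by apply/eqP => /(congr1 (fun u : V n => u.1 : nat)); rewrite E1 E2; lia.
Qed.

Lemma mid_ve x y : x <= n -> y.+1 < n -> mid (ve x y) = (x.*2, y.*2.+1).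
Proof.
move=> xn yn; have [E1 E2] : (vx x y).2 = y :> nat /\ (vx x y.+1).2 = y.+1 :> nat.
  by rewrite !inordK //; lia.
rewrite mid_set2 ?E1 ?E2 ?inordK //; first by congr pair; lia.
by apply/eqP => /(congr1 (fun u : V n => u.2 : nat)); rewrite E1 E2; lia.
Qed.

Lemma adjP u v : adj u v ->
  [\/ [/\ v.1 = u.1.+1 :> nat, v.2 = u.2 :> nat & [set u; v] = he u.1 u.2],
      [/\ u.1 = v.1.+1 :> nat, v.2 = u.2 :> nat & [set u; v] = he v.1 v.2],
      [/\ v.2 = u.2.+1 :> nat, v.1 = u.1 :> nat & [set u; v] = ve u.1 u.2] |
      [/\ u.2 = v.2.+1 :> nat, v.1 = u.1 :> nat & [set u; v] = ve v.1 v.2]].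
Proof.
case/orP => /andP[/eqP e1 /orP[] /eqP e2].
- by constructor 3; split=> //; rewrite /ve e2 {2}e1 !vx_val.
- by constructor 4; split=> //; rewrite /ve e2 -{2}e1 !vx_val setUC.
- by constructor 1; split=> //; rewrite /he e2 {2}e1 !vx_val.
- by constructor 2; split=> //; rewrite /he e2 -{2}e1 !vx_val setUC.
Qed.

Section Chunk.
Variables (k m q : nat).

(** Horizontal edges, then vertical edges off the two lateral sides. Both index grids are square,
    and the shift [x.+1] in [chunk_edge] turns the dual [(y.+1, x.-1)] of a vertical edge into a
    plain swap of indices. *)
Definition chunk_index := ('I_k * 'I_k + 'I_k.-1 * 'I_k.-1)%type.

Definition chunk_edge (l : chunk_index) : {set V n} :=
  match l with
  | inl (x, y) => he (q + x) (m + y)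
  | inr (x, y) => ve (q + x.+1) (m + y)
  end.

Definition chunk_swap (l : chunk_index) : chunk_index :=
  match l with
  | inl (x, y) => inl (y, x)
  | inr (x, y) => inr (y, x)
  end.

Lemma chunk_swapK : involutive chunk_swap.
Proof. by case=> [[]|[]]. Qed.

Lemma he_chunk x y : x < k -> y < k -> he (q + x) (m + y) \in codom chunk_edge.
Proof. by move=> xk yk; apply/codomP; exists (inl (Ordinal xk, Ordinal yk)). Qed.

Lemma ve_chunk x y : 0 < x < k -> y.+1 < k -> ve (q + x) (m + y) \in codom chunk_edge.
Proof.
case: x => // x xk yk; have xk' : x < k.-1 by lia.
have yk' : y < k.-1 by lia.
by apply/codomP; exists (inr (Ordinal xk', Ordinal yk')).
Qed.

(** Closed edges are the b-edges, so this is a crossing by a-edges. *)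
Definition chunk_crossing om :=
  crossing k (fun x y => om (he (q + x) (m + y))) (fun x y => om (ve (q + x) (m + y))).

Definition blocked om : bool := `[< ~ chunk_crossing om >].

Hypotheses (mk : m + k <= n) (qk : q + k <= n).

(** The inequalities are strict because vertical edges on the sides are excluded; hence consecutive
    chunks share no edge. *)
Lemma mid_chunk l : q.*2 < (mid (chunk_edge l)).1 < (q + k).*2.
Proof.
case: l => [[x y]|[x y]]; have := ltn_ord x; have := ltn_ord y => ? ?.
  by rewrite -[chunk_edge _]/(he _ _) mid_he /=; lia.
by rewrite -[chunk_edge _]/(ve _ _) mid_ve /=; lia.
Qed.

Lemma mid_chunk_edge l : mid (chunk_edge l) =
  match l with
  | inl (x, y) => ((q + x).*2.+1, (m + y).*2)
  | inr (x, y) => ((q + x.+1).*2, (m + y).*2.+1)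
  end.
Proof.
case: l => [[x y]|[x y]]; have := ltn_ord x; have := ltn_ord y => ? ?.
  by rewrite -[chunk_edge _]/(he _ _) mid_he //; lia.
by rewrite -[chunk_edge _]/(ve _ _) mid_ve //; lia.
Qed.

Lemma chunk_edge_inj : injective chunk_edge.
Proof.
move=> l l' /(congr1 mid); rewrite !mid_chunk_edge.
case: l l' => [[x y]|[x y]] [[x' y']|[x' y']] [e1 e2].
- by congr (inl (_, _)); apply: val_inj => /=; lia.
- by lia.
- by lia.
- by congr (inr (_, _)); apply: val_inj => /=; lia.
Qed.

(** If neither were blocked, the configuration and its dual would both have a crossing, against
    [no_double_crossing]. *)
Lemma blocked_dual om :
  blocked om || blocked (dualize chunk_edge chunk_swap om).
Proof.
apply/orP; have [|b] := boolP (blocked om); first by left.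
right; apply/asboolP => cr2; move/asboolPn: b => /contrapT cr1.
apply: (no_double_crossing cr1); apply: crossing_ext cr2 => x y.
  move=> xk yk; rewrite -[he _ _]/(chunk_edge (inl (Ordinal xk, Ordinal yk))).
  by rewrite dualizeE //; exact: chunk_edge_inj.
case: x => // x xk yk; have xk' : x < k.-1 by lia.
have yk' : y < k.-1 by lia.
rewrite -[ve _ _]/(chunk_edge (inr (Ordinal xk', Ordinal yk'))).
by rewrite dualizeE //; exact: chunk_edge_inj.
Qed.

Lemma blocked_ext om om' :
  (forall e, e \in codom chunk_edge -> om e = om' e) -> blocked om = blocked om'.
Proof.
move=> eqom; apply: asbool_equiv_eq; split; apply: contra_not; apply: crossing_ext => x y *;
  by rewrite eqom // ?he_chunk ?ve_chunk.
Qed.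

Definition path_edges (g : seq (V n)) : seq {set V n} :=
  [seq [set z.1; z.2] | z <- zip g (behead g)].

Definition in_strip u := m <= u.2 < m + k.

Lemma blocked_path om u p :
  path (@adj n) u p -> all in_strip (u :: p) ->
  u.1 = 0 :> nat -> (last u p).1 = n :> nat -> blocked om ->
  exists2 e, e \in path_edges (u :: p) & (e \in codom chunk_edge) && om e.
Proof.
move=> adj_p rows u0 lastn /asboolP nocross.
apply: contrapT => noE.
have {}noE e : e \in path_edges (u :: p) -> e \in codom chunk_edge -> ~~ om e.
  by move=> e1 e2; apply/negP => ome; apply: noE; exists e => //; rewrite e2.
set h := fun x y => om (he (q + x) (m + y)).
set v := fun x y => om (ve (q + x) (m + y)).
pose reach z := exists y s, [/\ y < k, path (cstep k h v) (0, y) s & last (0, y) s = z].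
have reachS z z' : reach z -> cstep k h v z z' -> reach z'.
  move=> [y [s [yk ps ls]]] zz'; exists y, (rcons s z').
  by rewrite rcons_path ls last_rcons ps.
(* If all edges of the path inside the chunk were open, the path could not get past
   the part of the chunk that is reachable from its left side. *)
pose Q (z : V n) := z.1 <= q \/ reach (z.1 - q, z.2 - m) /\ z.1 < q + k.
have Qstep z z' : adj z z' -> in_strip z -> in_strip z' -> Q z ->
    ([set z; z'] \in codom chunk_edge -> ~~ om [set z; z']) -> Q z'.
  rewrite /in_strip => zz' rz rz' Qz free.
  have [?|lt] := leqP z'.1 q; first by left.
  have zq : q <= z.1 < q + k.
    by case: Qz => [|[_]]; case: (adjP zz') => -[]; lia.
  have rzz : reach (z.1 - q, z.2 - m).
    (* Here [z] is on the left side of the chunk, where the empty path reaches it. *)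
    case: Qz => [le|[] //]; exists (z.2 - m), [::]; split => //=; first lia.
    by congr pair; lia.
  have stz : cstep k h v (z.1 - q, z.2 - m) (z'.1 - q, z'.2 - m).
    have [zE1 zE2] : q + (z.1 - q) = z.1 /\ m + (z.2 - m) = z.2 by lia.
    have [zE3 zE4] : q + (z'.1 - q) = z'.1 /\ m + (z'.2 - m) = z'.2 by lia.
    have Hh (y : V n) : q <= y.1 < q + k -> m <= y.2 < m + k ->
        [set z; z'] = he y.1 y.2 -> ~~ om (he y.1 y.2).
      move=> ? ? zzE; rewrite -zzE; apply: free; rewrite zzE.
      have := @he_chunk (y.1 - q) (y.2 - m); rewrite !subnKC; lia.
    have Hv (y : V n) : q < y.1 < q + k -> m <= y.2 -> y.2.+1 < m + k ->
        [set z; z'] = ve y.1 y.2 -> ~~ om (ve y.1 y.2).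
      move=> ? ? ? zzE; rewrite -zzE; apply: free; rewrite zzE.
      have := @ve_chunk (y.1 - q) (y.2 - m); rewrite !subnKC; lia.
    clear -rz rz' zq lt zE1 zE2 zE3 zE4 Hh Hv zz'.
    case: (adjP zz') => -[e1 e2 eE]; apply/or4P;
      [constructor 1 | constructor 2 | constructor 3 | constructor 4];
      apply/and5P; split; rewrite /h /v /= ?zE1 ?zE2 ?zE3 ?zE4; try lia.
    - by apply: Hh => //; lia.
    - by apply: Hh => //; lia.
    - by apply: Hv => //; lia.
    - by apply: Hv => //; lia.
  have rz2 := reachS _ _ rzz stz.
  (* Arriving in column [q + k] would complete a crossing of the chunk. *)
  right; split=> //; rewrite ltnNge; apply/negP => ge.
  apply: nocross; case: rz2 => y [s [yk ps ls]]; exists y, s; split=> //.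
  by rewrite ls /=; case: (adjP zz') => -[]; lia.
have Qlast : Q (last u p).
  have : Q u by left; rewrite u0.
  elim: p u adj_p rows noE {u0 lastn} => //= z p IH u /andP[uz pz] /and3P[ru rz rp] noE Qu.
  apply: IH => //; first by rewrite /= rz.
    by move=> e eE; apply: noE; rewrite /path_edges /= inE eE orbT.
  by apply: (Qstep u) => // ; apply: noE; rewrite /path_edges /= inE eqxx.
case: Qlast; rewrite lastn; last by case=> _; lia.
have : 0 < k; last by lia.
by case/andP: rows; rewrite /in_strip; lia.
Qed.

End Chunk.
End Lattice.

(** * Crossing times of strips *)

Section Strips.
Variables (n' k : nat).
Local Notation n := n'.+1.
Implicit Types (u v : V n) (e : {set V n}) (om : config n) (g : seq (V n)).

Definition strip_path m g :=
  exists u p, [/\ g = u :: p, path (@adj n) u p, uniq g & u.1 = 0 :> nat] /\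
    (last u p).1 = n :> nat /\ all (in_strip k m) g.

Definition strip_edges m : {set {set V n}} :=
  [set [set z.1; z.2] | z in [pred z : V n * V n |
     [&& adj z.1 z.2, in_strip k m z.1 & in_strip k m z.2]]].

Lemma strip_path_edges m g e :
  strip_path m g -> e \in path_edges g -> e \in strip_edges m.
Proof.
move=> [u [p [[-> pp _ _] [_ pin]]]].
elim: p u pp pin => [|v p IH] u; first by rewrite /path_edges.
rewrite /= => /andP[uv vp] /and3P[ru rv rp].
rewrite /path_edges /= inE => /orP[/eqP->|eE].
  by apply/imsetP; exists (u, v) => //; rewrite !inE /= uv ru rv.
by apply: (IH v) => //=; rewrite rv.
Qed.

(** An edge is determined by its left or lower endpoint and its direction, and
    [2 (n + 1) k <= 4 n k]. *)
Lemma card_strip_edges m : #|strip_edges m| <= 4 * n * k.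
Proof.
pose f (t : 'I_n.+1 * 'I_k * bool) : {set V n} :=
  if t.2 then he n' t.1.1 (m + t.1.2) else ve n' t.1.1 (m + t.1.2).
apply: (@leq_trans #|[set f t | t in [set: 'I_n.+1 * 'I_k * bool]]|).
  apply: subset_leq_card; apply/subsetP => e /imsetP[[u v]].
  rewrite inE /= /in_strip => /and3P[uv ru rv] ->.
  have H (w : V n) c : m <= w.2 < m + k ->
      (if c then he n' w.1 w.2 else ve n' w.1 w.2) \in [set f t | t in [set: 'I_n.+1 * 'I_k * bool]].
    move=> rw; have wk : w.2 - m < k by lia.
    apply/imsetP; exists (w.1, Ordinal wk, c) => //.
    by rewrite /f /= subnKC //; lia.
  case: (adjP uv) => -[_ _ ->].
  - exact: (H u true).
  - exact: (H v true).
  - exact: (H u false).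
  - exact: (H v false).
apply: leq_trans (leq_imset_card _ _) _.
by rewrite cardsT !card_prod !card_ord card_bool; lia.
Qed.

Lemma strip_edges_meet m m' :
  ~~ [disjoint strip_edges m & strip_edges m'] -> m < m' + k.
Proof.
case/pred0Pn => e /andP[/imsetP[[u v]]] /=.
rewrite inE /= /in_strip => /and3P[_ ru _] -> /imsetP[[u' v']].
rewrite inE /= /in_strip => /and3P[_ ru' rv'] eqE.
have : u \in [set u'; v'] by rewrite -eqE !inE eqxx.
by rewrite !inE => /orP[] /eqP Eu; move: ru; rewrite Eu; lia.
Qed.

(** All indices lie less than [k] above the smallest one. *)
Lemma card_meeting_strips d (J : {set 'I_d}) :
  {in J &, forall i j : 'I_d, ~~ [disjoint strip_edges i & strip_edges j]} -> #|J| <= k.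
Proof.
move=> meet; have [->|[i0 i0J]] := set_0Vmem J; first by rewrite cards0.
have [i iJ imin] := arg_minnP (fun i : 'I_d => val i) i0J.
have: uniq [seq val j | j <- enum J] by rewrite (map_inj_uniq val_inj) enum_uniq.
move=> /(@uniq_leq_size _ _ (iota i k)); rewrite size_map -cardE size_iota; apply.
move=> y /mapP[j]; rewrite mem_enum => jJ ->; rewrite mem_iota.
by rewrite imin //= (strip_edges_meet (meet j i jJ iJ)).
Qed.

Lemma strip_path_in_Pk m g : strip_path m g -> in_Pk k g.
Proof.
move=> [u [p [H [last_n rows]]]]; exists u, p; split=> //; split=> //; exists (Posz m).
by apply: sub_all rows => v; rewrite /in_strip; lia.
Qed.

Hypothesis kn : 0 < k <= n.

Lemma in_Pk_strip g : in_Pk k g -> exists m : 'I_(n - k).+1, strip_path m g.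
Proof.
move=> [u [p [H [last_n [m rows]]]]].
(* A strip that sticks out of the box is shifted back into it. *)
pose m' := minn (if m is Posz m0 then m0 else 0) (n - k).
have ltm : m' < (n - k).+1 by rewrite ltnS geq_minr.
exists (Ordinal ltm), u, p; split=> //; split=> //=.
apply: sub_all rows => v; rewrite /in_strip /m' /=; have := ltn_ord v.2; case: (m) => ?; lia.
Qed.

(* Hence the infimum defining [tau] is not the junk value [inf set0 = 0]. *)
Lemma strip_path0 : exists g, strip_path 0 g.
Proof.
exists [seq vx n' i 0 | i <- iota 0 n.+1], (vx n' 0 0), [seq vx n' i 0 | i <- iota 1 n].
have vxE i : i <= n -> (vx n' i 0).1 = i :> nat by move=> ?; rewrite inordK.
split; [split=> //|split].
- have adj_row d i : i + d <= n -> path (@adj n) (vx n' i 0) [seq vx n' j 0 | j <- iota i.+1 d].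
    elim: d i => //= d IH i id; rewrite IH; last by lia.
    by rewrite /adj !vxE ?eqxx ?orbT //; lia.
  exact: (adj_row n 0).
- rewrite map_inj_in_uniq ?iota_uniq // => i j; rewrite !mem_iota => ? ?.
  by move=> /(congr1 (fun u : V n => u.1 : nat)); rewrite !vxE //; lia.
- exact: vxE.
- rewrite (last_map (fun i => vx n' i 0) (iota 1 n) 0).
  have -> : last 0 (iota 1 n) = n by rewrite -nth_last size_iota nth_iota.
  exact: vxE.
- by apply/allP => _ /mapP[i _ ->]; rewrite /in_strip /= inordK //; lia.
Qed.

Local Open Scope ring_scope.
Variables (R : realType) (a b : R).
Hypotheses (a_gt0 : 0 < a) (ltab : a < b).

Lemma Tpath_edges om g : Tpath a b om g = \sum_(e <- path_edges g) wt a b om e.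
Proof. by rewrite big_map. Qed.

Lemma Tpath_ge0 om g : 0 <= Tpath a b om g.
Proof.
by apply: sumr_ge0 => e _; rewrite /wt; case: ifP => _; rewrite ltW // (lt_trans a_gt0).
Qed.

Lemma wt_flip_le e om e' : om e -> wt a b (flip e om) e' <= wt a b om e'.
Proof.
move=> ome; rewrite /wt ffunE; case: eqVneq => [->|_] //.
by rewrite ome; exact: ltW.
Qed.

Lemma Tpath_flip_le e om g : om e -> Tpath a b (flip e om) g <= Tpath a b om g.
Proof. by move=> ome; apply: ler_sum => z _; exact: wt_flip_le. Qed.

Lemma Tpath_flip e om g : om e -> e \in path_edges g ->
  Tpath a b (flip e om) g <= Tpath a b om g - (b - a).
Proof.
move=> ome eg; rewrite !Tpath_edges !(big_rem e eg) /=.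
have -> : wt a b (flip e om) e = wt a b om e - (b - a).
  by rewrite /wt ffunE eqxx ome; ring.
by rewrite [leRHS]addrAC lerD2l; apply: ler_sum => z _; exact: wt_flip_le.
Qed.

Lemma Tpath_flip_out e om g : e \notin path_edges g ->
  Tpath a b (flip e om) g = Tpath a b om g.
Proof.
rewrite !Tpath_edges => eg; apply: eq_big_seq => e' e'g.
by rewrite /wt ffunE; case: eqP => // e'E; rewrite -e'E e'g in eg.
Qed.

Definition fast (x : R) m om : bool :=
  `[< exists g, strip_path m g /\ Tpath a b om g < x >].

Lemma fast_loc x m e om : e \notin strip_edges m -> fast x m (flip e om) = fast x m om.
Proof.
move=> eN; apply: asbool_equiv_eq; split=> -[g [gs]] H; exists g; split=> //; move: H;
  rewrite Tpath_flip_out //; apply: contra eN; exact: strip_path_edges.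
Qed.

Lemma fast_flip x m e om : om e -> fast x m om -> fast x m (flip e om).
Proof.
move=> ome /asboolP[g [gs Tg]]; apply/asboolP; exists g; split=> //.
exact: le_lt_trans (Tpath_flip_le _ ome) Tg.
Qed.

(** * Blocked chunks as a supply of pivotal edges *)

Definition num_blocked m om := (\sum_(j < n %/ k) blocked k m (j * k) om)%N.

Lemma chunk_le (j : nat) : (j < n %/ k)%N -> (j * k + k <= n)%N.
Proof.
by move=> jM; rewrite -mulSnr (leq_trans _ (leq_trunc_div n k)) // leq_pmul2r //; lia.
Qed.

Lemma chunk_edges_neq m j j' e : (m + k <= n)%N -> (j < n %/ k)%N -> (j' < n %/ k)%N ->
  e \in codom (@chunk_edge n' k m (j * k)) -> e \in codom (@chunk_edge n' k m (j' * k)) ->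
  j = j'.
Proof.
move=> mk jM j'M /codomP[l ->] /codomP[l' E].
have := mid_chunk mk (chunk_le jM) l; have := mid_chunk mk (chunk_le j'M) l'.
rewrite -E; set t := (mid _).1 => H1 H2.
have {H1 H2} [H1 H2] : (j * k < j'.+1 * k /\ j' * k < j.+1 * k)%N by lia.
by move: H1 H2; rewrite !ltn_pmul2r; lia.
Qed.

(** The fast crossing has a b-edge in each blocked chunk. These edges are distinct since chunks are
    edge-disjoint, and flipping any one of them saves [b - a]. *)
Lemma num_blocked_pivotal x m om beta :
  (m + k <= n)%N -> (beta <= num_blocked m om)%N -> fast (x + (b - a)) m om ->
  (beta <= #|[set e in strip_edges m | om e && fast x m (flip e om)]|)%N.
Proof.
move=> mk le_beta /asboolP[g [gs Tg]].
have [f fP] : exists f : 'I_(n %/ k) -> {set V n}, forall j : 'I_(n %/ k),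
    blocked k m (j * k) om ->
    f j \in path_edges g /\ f j \in codom (@chunk_edge n' k m (j * k)) /\ om (f j).
  apply: (fin_all_exists (P := fun (j : 'I_(n %/ k)) e => blocked k m (j * k) om ->
    e \in path_edges g /\ e \in codom (@chunk_edge n' k m (j * k)) /\ om e)) => j.
  have [bl|_] := boolP (blocked k m (j * k) om); last by exists set0.
  case: gs => u [p [[gE pp _ u0] [ln rows]]]; rewrite gE in rows *.
  have [e eg /andP[ec ome]] := blocked_path mk (chunk_le (ltn_ord j)) pp rows u0 ln bl.
  by exists e.
pose J := [set j : 'I_(n %/ k) | blocked k m (j * k) om].
apply: leq_trans le_beta _.
have -> : num_blocked m om = #|J|.
  rewrite -sum1_card [RHS]big_mkcond /=; apply: eq_bigr => j _; rewrite inE.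
  by case: (blocked _ _ _ _).
have f_inj : {in J &, injective f}.
  move=> j j'; rewrite !inE => /fP[_ [c1 _]] /fP[_ [c2 _]] E; apply: val_inj.
  by apply: (chunk_edges_neq mk (ltn_ord j) (ltn_ord j') c1); rewrite E.
rewrite -(card_in_imset f_inj); apply: subset_leq_card; apply/subsetP => _ /imsetP[j jJ ->].
move: jJ; rewrite inE => /fP[fg [_ omf]]; rewrite inE (strip_path_edges gs) // omf /=.
apply/asboolP; exists g; split=> //; apply: le_lt_trans (Tpath_flip omf fg) _; lra.
Qed.

Lemma few_blocked_le m beta : (m + k <= n)%N -> (8 * beta <= n %/ k)%N ->
  #|[set om | num_blocked m om < beta]%N|%:R * 4 ^+ beta <= #|{: config n}|%:R :> R.
Proof.
move=> mk le8.
apply: (@few_successes_le R _ (n %/ k) (fun j => @blocked n' k m (j * k))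
  (fun j => dualize (@chunk_edge n' k m (j * k)) (@chunk_swap k)) beta le8).
- move=> j jM; apply: inv_inj; apply: dualizeK; last exact: chunk_swapK.
  exact: chunk_edge_inj (chunk_le jM).
- by move=> j om jM; apply: blocked_dual => //; exact: chunk_le.
- move=> j j' om jM j'M jj'; apply: blocked_ext => e ec.
  rewrite dualize_out //; apply: contra jj' => ec'.
  by apply/eqP; apply: chunk_edges_neq ec' ec.
Qed.

(** * Windows for the passage time *)

Lemma tau_le om x g : x <= tau a b k om -> in_Pk k g -> x <= Tpath a b om g.
Proof.
move=> xt gP; apply: le_trans xt _; apply: ge_inf; last by exists g.
by exists 0 => _ [h [_ ->]]; exact: Tpath_ge0.
Qed.

Lemma tau_lt om x : tau a b k om < x -> exists g, in_Pk k g /\ Tpath a b om g < x.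
Proof.
case/inf_lt; last by move=> _ [g [gP ->]] lt; exists g.
have [g /strip_path_in_Pk gP] := strip_path0.
by exists (Tpath a b om g), g.
Qed.

(** Half-open, so that consecutive windows tile and the upper bound provides a path of time strictly
    below [y]. *)
Definition window x y := [set om : config n | (x <= tau a b k om) && (tau a b k om < y)].

(** The constant is [48 = 3 * 4^2], a strip having at most [4 n k] edges. The last term is a union
    bound, over at most [n] strips, for having fewer than [beta] blocked chunks. *)
Lemma card_window_le x (s : R) (beta : nat) : 0 < s -> (8 * beta <= n %/ k)%N ->
  beta%:R * #|window x (x + (b - a))|%:R <= #|{: config n}|%:R *
    (2 * (k%:R * s + 48 * n%:R ^+ 3 * k%:R ^+ 2 / s ^+ 3) + beta%:R * n%:R / 4 ^+ beta).
Proof.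
move=> s0 le8.
pose I := 'I_(n - k).+1.
have mk (m : I) : (m + k <= n)%N by have := ltn_ord m; lia.
have cI : (#|{: I}| <= n)%N by rewrite card_ord; lia.
pose W (m : I) om := (beta <= num_blocked m om)%N && fast (x + (b - a)) m om.
pose Good := [set om | [exists m : I, W m om] && [forall m : I, ~~ fast x m om]].
pose Bad (m : I) := [set om | num_blocked m om < beta]%N.
have good_le : beta%:R * #|Good|%:R <= 2 * #|{: config n}|%:R *
    (k%:R * s + 3 * #|{: I}|%:R * (4 * n * k)%:R ^+ 2 / s ^+ 3).
  apply: (@anticoncentration R _ _ (fun m : I => strip_edges m) (fun m : I => fast x m) W) => //.
  - by move=> m e om; exact: fast_loc.
  - by move=> m e om; exact: fast_flip.
  - by move=> m om /andP[le fm] _; exact: num_blocked_pivotal.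
  - by move=> J; exact: card_meeting_strips.
  - by move=> m; exact: card_strip_edges.
have bad_le : #|\bigcup_m Bad m|%:R * 4 ^+ beta <= n%:R * #|{: config n}|%:R :> R.
  apply: (@le_trans _ _ (\sum_m #|Bad m|%:R * 4 ^+ beta)).
    rewrite -mulr_suml ler_wpM2r ?exprn_ge0 // -natr_sum ler_nat.
    elim/big_rec2: _ => [|m A c _ le]; first by rewrite cards0.
    by rewrite (leq_trans (leq_card_setU _ _)) ?leq_add2l.
  apply: (@le_trans _ _ (\sum_(m : I) #|{: config n}|%:R)).
    by apply: ler_sum => m _; exact: few_blocked_le.
  by rewrite sumr_const -[leLHS]mulr_natl ler_wpM2r // ler_nat.
have sub : window x (x + (b - a)) \subset Good :|: \bigcup_m Bad m.
  apply/subsetP => om; rewrite inE => /andP[xt tx]; rewrite inE.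
  have [//|noBad] := boolP (om \in \bigcup_m Bad m); first by rewrite orbT.
  rewrite orbF inE; apply/andP; split.
    have [g [gP Tg]] := tau_lt tx; have [m gm] := in_Pk_strip gP.
    apply/existsP; exists m; rewrite /W leqNgt; apply/andP; split.
      by apply: contra noBad => lt; apply/bigcupP; exists m; rewrite // inE.
    by apply/asboolP; exists g.
  apply/forallP => m; apply/asboolPn => -[g [/strip_path_in_Pk gP]].
  by rewrite ltNge (tau_le xt gP).
have {sub} card_le : #|window x (x + (b - a))|%:R
    <= #|Good|%:R + #|\bigcup_m Bad m|%:R :> R.
  by rewrite -natrD ler_nat (leq_trans (subset_leq_card sub)) // leq_card_setU.
apply: le_trans (ler_wpM2l (ler0n _ _) card_le) _; rewrite mulrDr [leRHS]mulrDr lerD //.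
  apply: le_trans good_le _; rewrite [2 * _]mulrC. rewrite -[leLHS]mulrA. rewrite ler_pM2l; last first.
    by rewrite ltr0n; apply/card_gt0P; exists [ffun=> false].
  rewrite ler_pM2l //.
  rewrite lerD2l ler_pM2r ?invr_gt0 ?exprn_gt0 //.
  apply: (@le_trans _ _ (3 * n%:R * (4 * n * k)%:R ^+ 2)).
    by rewrite ler_wpM2r ?exprn_ge0 // ler_pM2l // ler_nat.
  by rewrite !natrM le_eqVlt; apply/orP; left; apply/eqP; ring.
have -> : #|{: config n}|%:R * (beta%:R * n%:R / 4 ^+ beta) =
    beta%:R * (n%:R * #|{: config n}|%:R / 4 ^+ beta) :> R by ring.
by rewrite ler_wpM2l // ler_pdivlMr ?exprn_gt0.
Qed.

End Strips.

(** * Asymptotics *)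

Local Open Scope ring_scope.

Section Asymptotics.
Variables (n' k : nat).
Local Notation n := n'.+1.
Variables (R : realType) (a b t : R).
Hypotheses (a_gt0 : 0 < a) (ltab : a < b) (k_gt0 : (0 < k)%N).
Hypotheses (t_ge2 : 2 <= t) (nt : n%:R = t ^+ 22) (kt : k%:R <= t).

(** With [s = t^18], [k s] is at most [t^19] and [n^3 k^2 / s^3] at most [t^14]; dividing by
    [beta >= t^21 / 16] leaves [t^-2]. The constant is [1824 = 2 (16 + 48 * 16) + 256]. *)
Lemma card_window_le_root x :
  #|window n' k a b x (x + (b - a))|%:R * t ^+ 2
    <= 1824 * #|{: config n}|%:R.
Proof.
have t0 : 0 < t by apply: lt_le_trans t_ge2.
have t1 : 1 <= t by apply: le_trans t_ge2; rewrite ler1n.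
have tS i j : (i <= j)%N -> t ^+ i <= t ^+ j by move=> ij; rewrite ler_weXn2l.
have k0 : 0 <= k%:R :> R by [].
(* This makes [beta] positive, so that rounding down costs at most a factor 2 and
   [n <= 16 beta k]. *)
have k16 : (16 * k <= n)%N.
  rewrite -(ler_nat R) natrM nt exprS mulrC ler_pM //.
  apply: (@le_trans _ _ (2 ^+ 21)); first by rewrite -natrX ler_nat.
  by rewrite lerXn2r ?nnegrE // ltW.
have kn : (0 < k <= n)%N by lia.
pose beta := (n %/ k %/ 8)%N.
have le8 : (8 * beta <= n %/ k)%N by rewrite mulnC leq_trunc_div.
have := card_window_le kn a_gt0 ltab x (exprn_gt0 18 t0) le8.
have beta_ge : t ^+ 21 <= 16 * beta%:R.
  have : (n <= 16 * beta * k)%N.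
    rewrite /beta -divnMA; have := divn_eq n (k * 8); have := ltn_pmod n (_ : 0 < k * 8)%N.
    by rewrite muln_gt0 k_gt0 => /(_ isT); nia.
  rewrite -(ler_nat R) nt !natrM (exprSr t 21) => le.
  by rewrite -(ler_pM2r t0) (le_trans le) // ler_wpM2l // mulr_ge0.
have y0 : 0 < beta%:R :> R.
  by have := lt_le_trans (exprn_gt0 21 t0) beta_ge; rewrite pmulr_rgt0.
have pow4 : beta%:R ^+ 2 <= 4 ^+ beta :> R.
  by rewrite -!natrX ler_nat -[4%N]/(2 ^ 2)%N expnAC leq_sqr ltnW // ltn_expl.
set y : R := beta%:R in beta_ge y0 pow4 *; set Om : R := #|{: config n}|%:R.
set w : R := #|_|%:R; have Om0 : 0 <= Om by [].
have b1 : k%:R * t ^+ 18 <= t ^+ 19 by rewrite (exprS t 18) ler_pM2r ?exprn_gt0.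
have b2 : 48 * n%:R ^+ 3 * k%:R ^+ 2 / (t ^+ 18) ^+ 3 <= 48 * t ^+ 19.
  rewrite ler_pdivrMr ?exprn_gt0 // nt.
  apply: (@le_trans _ _ (48 * (t ^+ 22) ^+ 3 * t ^+ 2)).
    apply: ler_wpM2l; first by rewrite mulr_ge0 ?exprn_ge0 // ltW.
    by rewrite lerXn2r ?nnegrE // ltW.
  rewrite -[leLHS]mulrA -[leRHS]mulrA -!exprM -!exprD; apply: ler_wpM2l => //; exact: tS.
(* Quadratic growth of [4 ^+ beta] suffices: [n t^2 = t^24 <= t^42 <= 256 beta^2]. *)
have b3 : y * n%:R / 4 ^+ beta * t ^+ 2 <= 256 * y.
  rewrite nt mulrAC ler_pdivrMr ?exprn_gt0 // -mulrA -exprD [leRHS]mulrAC mulrC ler_pM2r //.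
  apply: le_trans (_ : 256 * y ^+ 2 <= _); last by rewrite ler_pM2l.
  apply: (@le_trans _ _ ((t ^+ 21) ^+ 2)); first by rewrite -exprM tS.
  have -> : 256 * y ^+ 2 = (16 * y) ^+ 2 by ring.
  by rewrite lerXn2r ?nnegrE ?exprn_ge0 // ltW // pmulr_rgt0.
have b4 : t ^+ 19 * t ^+ 2 <= 16 * y by rewrite -exprD.
move: b2 b3; set A := k%:R * t ^+ 18 in b1 *; set B := _ / (t ^+ 18) ^+ 3; set C := _ / 4 ^+ beta.
move=> b2 b3 le; have t2 : 0 <= t ^+ 2 by rewrite exprn_ge0 // ltW.
have sum_le : (2 * (A + B) + C) * t ^+ 2 <= 1824 * y.
  have {}b1 : A * t ^+ 2 <= 16 * y := le_trans (ler_wpM2r t2 b1) b4.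
  have {}b2 : B * t ^+ 2 <= 48 * (16 * y).
    by apply: le_trans (ler_wpM2r t2 b2) _; rewrite -mulrA ler_pM2l.
  rewrite [leLHS]mulrDl -mulrA mulrDl; lra.
rewrite -(ler_pM2l y0) mulrA; apply: le_trans (ler_wpM2r t2 le) _.
rewrite -mulrA; apply: le_trans (ler_wpM2l Om0 sum_le) _.
by rewrite mulrCA [y * _]mulrCA [y * Om]mulrC.
Qed.

Lemma card_long_window_le x m :
  #|window n' k a b x (x + m%:R * (b - a))|%:R * t ^+ 2
    <= m%:R * 1824 * #|{: config n}|%:R.
Proof.
elim: m => [|m IH].
  rewrite !mul0r addr0 (_ : window _ _ _ _ _ _ = set0) ?cards0 ?mul0r //.
  by apply/setP => om; rewrite !inE; case: ltP => _; rewrite ?andbF // ?andbT; case: leP.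
have sub : window n' k a b x (x + m.+1%:R * (b - a)) \subset
    window n' k a b x (x + m%:R * (b - a)) :|:
    window n' k a b (x + m%:R * (b - a)) (x + m%:R * (b - a) + (b - a)).
  apply/subsetP => om; rewrite !inE => /andP[-> lt] /=.
  have [//|/=] := ltP (tau a b k om) (x + m%:R * (b - a)).
  by move=> _; apply: lt_le_trans lt _; rewrite -natr1; lra.
have := leq_trans (subset_leq_card sub) (leq_card_setU _ _).
rewrite -(ler_nat R) natrD => /(ler_wpM2r (exprn_ge0 2 (le_trans (ler0n R 2) t_ge2))).
rewrite mulrDl => /le_trans; apply.
have := card_window_le_root (x + m%:R * (b - a)).
by rewrite -[m.+1]addn1 natrD => le; rewrite !mulrDl mul1r; exact: lerD IH le.
Qed.

End Asymptotics.

Theorem theorem1p2 (R : realType) (a b alpha c : R) (k : nat -> nat) :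
  0 < a -> a < b -> alpha < 1 / 22%:R ->
  (forall n : nat, (1 <= n)%N -> (0 < k n)%N) ->
  (forall n : nat, (1 <= n)%N -> (k n)%:R <= n%:R `^ alpha) ->
  0 < c ->
  forall eps : R, 0 < eps ->
    exists N : nat, forall n : nat, (N <= n)%N ->
      forall x : R, 0 <= x ->
        prob_window a b n (k n) x c <= eps / (n%:R `^ (1 / 22%:R)).
Proof.
move=> a_gt0 ltab alpha_lt k_gt0 k_le c_gt0 eps eps_gt0.
have d_gt0 : 0 < b - a by rewrite subr_gt0.
(* The closed interval of length [c] fits into [m] half-open windows of length [b - a]. *)
pose m := Num.bound (c / (b - a)).
have c_lt : c < m%:R * (b - a).
  by rewrite -ltr_pdivrMr // archi_boundP // divr_ge0 // ltW.
(* For [t >= T] the bound [1824 m / t^2] is at most [eps / t]; the summand 2 ensures [t >= 2]. *)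
pose T : R := 2 + m%:R * 1824 / eps.
have T_ge2 : 2 <= T by rewrite lerDl divr_ge0 ?mulr_ge0 // ltW.
have T_ge0 : 0 <= T by apply: le_trans T_ge2.
(* From [T^22 < n = t^22] follows [T <= t]; the successor rules out [n = 0]. *)
exists (Num.bound (T ^+ 22)).+1 => -[//|n'] ltN x _.
set n := n'.+1 in ltN *; set t := n%:R `^ (1 / 22%:R).
have n_ge1 : 1 <= n%:R :> R by rewrite ler1n.
have t_ge0 : 0 <= t by exact: powR_ge0.
have nt : n%:R = t ^+ 22.
  by rewrite -powR_mulrn // /t -powRrM mul1r mulVf ?powRr1 // pnatr_eq0.
have t_geT : T <= t.
  rewrite leNgt; apply/negP => ltT.
  have /lt_trans : t ^+ 22 < T ^+ 22 by rewrite ltrXn2r.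
  move=> /(_ _ (archi_boundP (exprn_ge0 22 T_ge0))).
  by rewrite -nt ltr_nat ltnNge ltnW.
have kt : (k n)%:R <= t.
  by apply: le_trans (k_le n _) _ => //; rewrite ler_powR // ltW.
have t_gt0 : 0 < t by apply: lt_le_trans (le_trans T_ge2 t_geT).
have := card_long_window_le a_gt0 ltab (k_gt0 n isT) (le_trans T_ge2 t_geT) nt kt x m.
set Om : R := #|{: config n}|%:R; set w := #|window _ _ _ _ _ _|%:R => le_w.
have Om0 : 0 < Om by rewrite ltr0n; apply/card_gt0P; exists [ffun=> false].
rewrite /prob_window ler_pdivrMr //.
apply: (@le_trans _ _ w).
  rewrite ler_nat; apply: subset_leq_card; apply/subsetP => om.
  rewrite in_setE /= inE => /andP[-> le] /=.
  by apply: le_lt_trans le _; rewrite ltrD2l.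
rewrite mulrAC ler_pdivlMr // -(ler_pM2r t_gt0) -mulrA -expr2 (le_trans le_w) //.
rewrite [leRHS]mulrAC ler_pM2r // [leRHS]mulrC -ler_pdivrMr //.
by apply: le_trans t_geT; rewrite /T lerDr.
Qed.
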